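(* Let $\mathbb{F}_q$ be a finite field of characteristic three and let $n>1$ be an integer. Then \[ |\mathcal{I}(x^3+x^2,\,1,\,n,\,q)|=\frac{1}{3n_3}\,I\bigl(n/n_3,q^{n_3}\bigr). \]
   Context: For coprime $g,h\in\mathbb{F}_q[x]$ and an integer $n>1$, $\mathcal{I}(g,h,n,q)$ denotes the set of monic irreducible polynomials $f\in\mathbb{F}_q[x]$ of degree $n$ such that $h(x)^n f\bigl(g(x)/h(x)\bigr)$ is irreducible in $\mathbb{F}_q[x]$. $n_3$ denotes the largest power of $3$ dividing $n$. For a positive integer $k$ and an integer $Q$, $I(k,Q)=\frac1k\sum_{d\mid k}\mu(d)Q^{k/d}$, where $\mu$ is the Möbius function. *)

(* Defs.v *)
From HB Require Import structures.
From mathcomp Require Import all_boot all_order all_algebra.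

Set Implicit Arguments.
Unset Strict Implicit.
Unset Printing Implicit Defensive.

Import GRing.Theory.
Local Open Scope ring_scope.

(* [rat_subst n g h f] is [h^n f(g/h)] with the denominators cleared, as the
   sum of the [f_i g^i h^(n-i)]; see [rat_substE] below. *)
Definition rat_subst (F : fieldType) (n : nat) (g h f : {poly F}) : {poly F} :=
  \sum_(i < n.+1) f`_i *: (g ^+ i * h ^+ (n - i)).

Lemma rat_substE (F : fieldType) (n : nat) (g h f : {poly F}) :
  h != 0 -> (size f <= n.+1)%N ->
  tofrac (rat_subst n g h f) =
    tofrac h ^+ n * (map_poly (@tofrac _ \o polyC) f).[tofrac g / tofrac h].
Proof.
move=> h0 sf; have h0' : tofrac h != 0 by rewrite tofrac_eq0.
rewrite (@horner_coef_wide _ n.+1); last by rewrite size_map_poly.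
rewrite /rat_subst rmorph_sum mulr_sumr; apply: eq_bigr => i _ /=.
have le_in : (i <= n)%N by rewrite -ltnS.
rewrite -mul_polyC !rmorphM !rmorphXn /= coef_map /= [RHS]mulrCA; congr (_ * _).
rewrite exprMn exprVn [RHS]mulrCA; congr (_ * _).
by apply: (canRL (mulfK _)); rewrite ?expf_neq0 // -exprD subnK.
Qed.

(* Polynomials of degree [n] are taken in the finite type of polynomials of
   size at most [n.+1], so that the set has a cardinality. *)
Definition irr_subst_set (F : finFieldType) (g h : {poly F}) (n : nat) :
    {set {poly_(n.+1) F}} :=
  [set f : {poly_(n.+1) F} |
    [&& size (f : {poly F}) == n.+1, (f : {poly F}) \is monic,
        irreducibleb (f : {poly F}) & irreducibleb (rat_subst n g h f)]].

(* [mobius 0] is a junk value. *)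
Definition mobius (d : nat) : int :=
  if all (fun p => logn p d == 1%N) (primes d) then (-1) ^+ size (primes d)
  else 0.

Definition necklace (k : nat) (Q : int) : rat :=
  k%:R^-1 * \sum_(d <- divisors k) (mobius d * Q ^+ (k %/ d)%N)%:~R.

(* Main.v *)
Require Import Defs.
From mathcomp Require Import all_boot all_order all_algebra.
From mathcomp Require Import falgebra fieldext separable galois finfield.
From mathcomp Require Import ring.

Set Implicit Arguments.
Unset Strict Implicit.
Unset Printing Implicit Defensive.

Import GRing.Theory Num.Theory.
Local Open Scope ring_scope.

(** Write q = |F| = 3^e, let L be the extension of F of degree n, so that
    |L| = 3^(e n), and let Tr be the absolute trace from L to the prime field.

    A monic irreducible f of degree n has exactly n roots in L, which form one
    orbit of the Frobenius map x |-> x^q. If a is one of them, Capelli's lemma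
    ([irreducible_comp_cubic]) says that f(g) is irreducible over F, for a cubic
    g, precisely when g takes no value a on L: every irreducible factor of f(g)
    has degree a multiple of n, so a proper factorization of the polynomial f(g)
    of degree 3n produces a factor of degree n, hence a point of L above a.
    Therefore n times the wanted number is the number of elements a of L with
    Frobenius orbit of length n such that x^3 + x^2 = a has no solution in L
    ([card_irr_subst_set]).

    In characteristic three the substitution x = 1/y turns x^3 + x^2 = a into
    y^3 - y/a = 1/a, whose left-hand side is additive in y; here a is non-zero
    because its orbit length n is greater than 1. If a is not a square, this
    additive map is injective and the equation is solvable. If a = b^2, the
    substitution x = b/z turns x^3 + x^2 = a into the Artin-Schreier equation
    z^3 - z = b, solvable exactly when Tr b = 0 ([artin_schreier3],
    [cubic_valuePn]). So the good a are the squares of the b with Tr b <> 0, and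
    b |-> b^2 is two-to-one. It also preserves the orbit length: if b^2 lies in
    the subfield with q^d elements while b does not, then b is conjugate to -b,
    which forces Tr b = 0 ([order_frob_sqr]).

    It remains to count the b of orbit length n with non-zero trace. On the
    subfield with q^(n/d) elements Tr is d times the trace of that subfield, so
    it vanishes if 3 divides d and is non-zero on two thirds of the elements
    otherwise ([card_fix_trace3]). Moebius inversion over the subfields gives
    (2/3) sum of mu(d) q^(n/d) over the divisors d of n prime to 3, which are
    the divisors of n/n_3, and the formula follows. *)

(** * Moebius inversion along the orbits of an injection *)

Lemma mobius_sqr0 p d : prime p -> (1 < logn p d)%N -> mobius d = 0.
Proof.
move=> pr_p lt1; rewrite /mobius; case: allP => // h.
have p_d : p \in primes d by rewrite -logn_gt0 (leq_trans _ lt1).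
by rewrite (eqP (h p p_d)) in lt1.
Qed.

Lemma mobius_mulp p d : prime p -> (0 < d)%N -> ~~ (p %| d)%N ->
  mobius (p * d) = - mobius d.
Proof.
move=> pr_p d_gt0 ndv; have p_gt0 := prime_gt0 pr_p.
have cop : coprime p d by rewrite prime_coprime.
have Dp : perm_eq (primes (p * d)) (p :: primes d).
  apply: uniq_perm; rewrite /= ?primes_uniq ?mem_primes ?(negPf ndv) ?andbF //.
  by move=> r; rewrite inE primesM // primes_prime // inE.
rewrite /mobius (perm_all _ Dp) (perm_size Dp) /=.
rewrite lognM // logn_prime // eqxx lognE pr_p d_gt0 (negPf ndv) /=.
rewrite exprS mulN1r.
have -> : all (fun r => logn r (p * d) == 1%N) (primes d) =
          all (fun r => logn r d == 1%N) (primes d).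
  apply: eq_in_all => r; rewrite mem_primes => /and3P[pr_r _ r_d].
  rewrite lognM // logn_prime //; have [Dr | //] := eqVneq r p.
  by rewrite -Dr r_d in ndv.
by case: ifP; rewrite ?oppr0.
Qed.

(** With p a prime divisor of k, the divisors d prime to p cancel against the
    divisors p * d; those divisible by p ^ 2 contribute nothing. *)
Lemma sum_mobius k : (0 < k)%N ->
  \sum_(d <- divisors k) mobius d = (k == 1%N)%:R.
Proof.
move=> k_gt0; case: eqVneq => [-> | kn1]; first by rewrite big_seq1.
have k_gt1 : (1 < k)%N by rewrite ltn_neqAle eq_sym kn1.
pose p := pdiv k; have pr_p : prime p := pdiv_prime k_gt1.
have p_gt0 := prime_gt0 pr_p.
have p_k : (p %| k)%N := pdiv_dvd k.
rewrite (bigID (fun d => p %| d)%N) /=.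
rewrite -[X in X + _]big_filter -[X in _ + X]big_filter.
set s1 := filter _ _; set s2 := filter _ _.
rewrite (bigID (fun d => 1 < logn p d)%N) /= big1 ?add0r; last first.
  by move=> d; apply: mobius_sqr0.
rewrite -big_filter; set s3 := filter _ _.
suff Ds3 : perm_eq s3 [seq (p * d)%N | d <- s2].
  rewrite (perm_big _ Ds3) big_map /= -big_split /= big1_seq // => d.
  rewrite mem_filter -dvdn_divisors // => /and3P[_ ndv d_k].
  by rewrite mobius_mulp ?addNr // (dvdn_gt0 k_gt0).
apply: uniq_perm; rewrite ?filter_uniq ?divisors_uniq //.
  rewrite map_inj_uniq ?filter_uniq ?divisors_uniq // => x y /eqP.
  by rewrite eqn_pmul2l // => /eqP.
move=> x; apply/idP/mapP => [|[d]].
  rewrite !mem_filter -dvdn_divisors // -leqNgt => /and3P[lx p_x x_k].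
  have x_gt0 := dvdn_gt0 k_gt0 x_k.
  have Dx : (x = p * (x %/ p))%N by rewrite mulnC divnK.
  have d_gt0 : (0 < x %/ p)%N by rewrite divn_gt0 // dvdn_leq.
  exists (x %/ p)%N => //; rewrite mem_filter -dvdn_divisors //.
  rewrite (dvdn_trans _ x_k) ?andbT; last by apply/dvdnP; exists p.
  apply/negP => p_d; move: lx; rewrite Dx lognM // logn_prime // eqxx.
  by rewrite lognE pr_p d_gt0 p_d.
rewrite !mem_filter -!dvdn_divisors // => /andP[ndv d_k] ->.
have d_gt0 := dvdn_gt0 k_gt0 d_k.
rewrite dvdn_mulr // Gauss_dvd ?prime_coprime // p_k d_k -leqNgt.
by rewrite lognM // logn_prime // eqxx lognE pr_p d_gt0 (negPf ndv).
Qed.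

Lemma iter_id_order (T : finType) (f : T -> T) (x : T) d :
  injective f -> (iter d f x == x) = (order f x %| d)%N.
Proof.
move=> f_inj; set o := order f x.
have iter_mul k : iter (k * o) f x = x.
  by elim: k => // k IH; rewrite mulSn iterD IH iter_order.
rewrite {1}(divn_eq d o) addnC iterD iter_mul.
have lt_o : (d %% o < o)%N by rewrite ltn_mod order_gt0.
apply/eqP/eqP => [Dx | -> //].
by rewrite -(findex_iter lt_o) Dx findex0.
Qed.

(** The points fixed by the iterate of index n / d are those whose orbit length
    divides n / d, so this is Moebius inversion for the counting function of
    orbit lengths. *)
Lemma mobius_order (T : finType) (f : T -> T) (P : pred T) n :
  injective f -> (0 < n)%N ->
  #|[set x | (order f x == n) && P x]|%:R =
  \sum_(d <- divisors n)
     mobius d * #|[set x | (iter (n %/ d) f x == x) && P x]|%:R.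
Proof.
move=> f_inj n_gt0.
have cardE (Q : pred T) :
    #|[set x | Q x && P x]|%:R = \sum_(x | P x) (Q x)%:R :> int.
  rewrite cardsE -sum1_card natr_sum big_mkcond [RHS]big_mkcond /=.
  by apply: eq_bigr => x _; rewrite unfold_in; case: (Q x); case: (P x).
rewrite cardE (eq_bigr (fun d => \sum_(x | P x)
    mobius d * (iter (n %/ d) f x == x)%:R)); last first.
  by move=> d _; rewrite cardE mulr_sumr.
rewrite exchange_big /=; apply: eq_bigr => x _; set o := order f x.
under eq_bigr do rewrite iter_id_order // -/o.
have [o_n | no_n] := boolP (o %| n)%N; last first.
  rewrite big1_seq => [|d /andP[_]].
    by case: eqP no_n => // ->; rewrite dvdnn.
  rewrite -dvdn_divisors // => d_n.
  case: (boolP (o %| n %/ d)%N) => [o_nd | _]; last exact: mulr0.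
  case/negP: no_n; apply: dvdn_trans o_nd _.
  by apply/dvdnP; exists d; rewrite mulnC divnK.
have o_gt0 : (0 < o)%N := order_gt0 f x.
have no_gt0 : (0 < n %/ o)%N by rewrite (divn_gt0 n o_gt0) (dvdn_leq n_gt0 o_n).
have -> : (o == n) = ((n %/ o)%N == 1%N).
  by rewrite -[RHS](eqn_pmul2r o_gt0) (divnK o_n) mul1n eq_sym.
transitivity (\sum_(d <- divisors n | (o %| n %/ d)%N) mobius d); last first.
  rewrite big_mkcond; apply: eq_bigr => d _.
  by case: ifP; rewrite ?mulr1 ?mulr0.
rewrite -sum_mobius // -[RHS]big_filter; apply: perm_big; apply: uniq_perm.
- exact: divisors_uniq.
- by rewrite filter_uniq ?divisors_uniq.
move=> d; rewrite mem_filter -!dvdn_divisors // andbC.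
apply/idP/andP => [d_no | [d_n o_nd]].
  have d_n : (d %| n)%N.
    by apply: dvdn_trans d_no _; apply/dvdnP; exists o; rewrite mulnC divnK.
  by split=> //; rewrite dvdn_divRL // mulnC -dvdn_divRL.
by rewrite dvdn_divRL // mulnC -dvdn_divRL.
Qed.

(** * Roots in a finite field *)

(** [X^|L| - X] is the product of the [X - x] for x in L, so its divisors split
    into distinct linear factors over L. *)
Lemma card_roots_dvd (L : finFieldType) (p : {poly L}) :
  p %| 'X^#|L| - 'X -> #|[set x | root p x]| = (size p).-1.
Proof.
rewrite finField_genPoly -big_enum /= => /dvdp_prod_XsubC[m Dp].
set s := mask m _ in Dp; have us : uniq s by rewrite mask_uniq ?enum_uniq.
rewrite (eqp_size Dp) size_prod_XsubC /= -(card_uniqP us).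
by apply: eq_card => x; rewrite inE (eqp_root Dp) root_prod_XsubC.
Qed.

Lemma card_roots_le (L : finFieldType) (p : {poly L}) :
  p != 0 -> (#|[set x | root p x]| <= (size p).-1)%N.
Proof.
move=> p0; rewrite -ltnS prednK ?size_poly_gt0 // cardE.
apply: max_poly_roots; rewrite ?enum_uniq //.
by apply/allP => x; rewrite mem_enum inE.
Qed.

(** * The absolute trace in characteristic three *)

(** On a field with 3 ^ M elements this is the trace to the prime field; it is
    defined in any ring because it is also used at the indeterminate X. *)
Definition trace3 (R : nzRingType) (M : nat) (x : R) : R :=
  \sum_(i < M) x ^+ (3 ^ i).

Section CharThree.

Variables (R : comNzRingType) (charR : 3%N \in [pchar R]).

Lemma expD_pow3 (k : nat) :
  {morph (fun x : R => x ^+ (3 ^ k)) : x y / x + y}.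
Proof.
move=> x y; apply: exprDn_pchar.
by rewrite pnatX pnatE ?(pcharf_prime charR) ?charR ?orbT.
Qed.

Lemma expB_pow3 (k : nat) :
  {morph (fun x : R => x ^+ (3 ^ k)) : x y / x - y}.
Proof.
move=> x y; apply: (canRL (addrK _)).
by rewrite /= -expD_pow3 ?subrK.
Qed.

Lemma exp_sum_pow3 (k M : nat) (f : nat -> R) :
  (\sum_(i < M) f i) ^+ (3 ^ k) = \sum_(i < M) f i ^+ (3 ^ k).
Proof.
apply: (big_morph (fun x : R => x ^+ (3 ^ k))).
  exact: expD_pow3.
by rewrite expr0n expn_eq0.
Qed.

Lemma trace3_AS (M : nat) (x : R) :
  trace3 M x ^+ 3 - trace3 M x = x ^+ (3 ^ M) - x.
Proof.
rewrite -[_ ^+ 3]/(_ ^+ (3 ^ 1)) /trace3.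
rewrite (exp_sum_pow3 1 M (fun i => x ^+ (3 ^ i))).
under eq_bigr do rewrite -exprM -expnD addn1.
rewrite -sumrB -(big_mkord predT (fun i => x ^+ (3 ^ i.+1) - x ^+ (3 ^ i))).
by rewrite (telescope_sumr (fun i => x ^+ (3 ^ i))) ?expr1.
Qed.

End CharThree.

Section Trace3.

Variables (L : finFieldType) (N : nat).
Hypothesis charL : 3%N \in [pchar L].
Hypothesis cardL : #|L| = (3 ^ N)%N.

Lemma trace3D M : {morph @trace3 L M : x y / x + y}.
Proof.
move=> x y; rewrite /trace3 -big_split; apply: eq_bigr => i _.
exact: expD_pow3 charL _ _ _.
Qed.

Lemma trace3N M x : trace3 M (- x) = - trace3 M x :> L.
Proof.
apply/eqP; rewrite -addr_eq0 -trace3D addNr /trace3 big1 // => i _.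
by rewrite expr0n expn_eq0.
Qed.

Lemma trace3_frob k x : trace3 N (x ^+ (3 ^ k)) = trace3 N x :> L.
Proof.
have trX y : trace3 N (y ^+ (3 ^ k)) = trace3 N y ^+ (3 ^ k) :> L.
  rewrite /trace3 (exp_sum_pow3 charL k N (fun i => y ^+ (3 ^ i))) //.
  by apply: eq_bigr => i _; rewrite exprAC.
have: trace3 N x ^+ 3 = trace3 N x.
  by apply/eqP; rewrite -subr_eq0 trace3_AS // -cardL expf_card subrr.
rewrite trX => T3; elim: k {trX} => [|k IH]; first by rewrite expr1.
by rewrite expnS exprM T3.
Qed.

(** For M * r = N, transitivity of the trace: on the subfield with 3 ^ M
    elements the relative trace is multiplication by the degree r. *)
Lemma trace3_sub M r x : x ^+ (3 ^ M) = x ->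
  trace3 (M * r) x = r%:R * trace3 M x :> L.
Proof.
move=> xM; have xMk k i : x ^+ (3 ^ (k * M + i)) = x ^+ (3 ^ i).
  by elim: k => // k IH; rewrite mulSn -addnA expnD exprM xM.
elim: r => [|r IH]; first by rewrite muln0 /trace3 big_ord0 mul0r.
rewrite mulnS addnC /trace3 big_split_ord /= -/(trace3 _ _) IH.
rewrite mulrS mulrDl mul1r addrC.
by congr (_ + _); apply: eq_bigr => i _; rewrite mulnC xMk.
Qed.

Lemma dvdp_X3exp (R : fieldType) M r : 3%N \in [pchar R] ->
  ('X^(3 ^ M) - 'X : {poly R}) %| 'X^(3 ^ (M * r)) - 'X.
Proof.
move=> charR; elim: r => [|r IH]; first by rewrite muln0 expr1 subrr dvdp0.
have charP : 3%N \in [pchar {poly R}] by rewrite pchar_poly.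
(* X^(AB) - X = (X^B - X)^A + (X^A - X), with A = 3^M and B = 3^(Mr). *)
rewrite mulnS addnC expnD exprM -(subrK ('X^(3 ^ M)) ('X^_ ^+ _)) -addrA.
by rewrite dvdp_add // -expB_pow3 // dvdp_exp // expn_gt0.
Qed.

Lemma size_trace3X M : (0 < M)%N ->
  size (trace3 M ('X : {poly L})) = (3 ^ M.-1).+1.
Proof.
case: M => // M _; rewrite /trace3 big_ord_recr /= addrC.
rewrite size_polyDl size_polyXn //.
apply: leq_ltn_trans (size_sum _ _ _) _; apply/bigmax_leqP_seq => i _ _ /=.
by rewrite size_polyXn ltn_exp2l.
Qed.

Lemma horner_trace3X M x : (trace3 M ('X : {poly L})).[x] = trace3 M x.
Proof.
by rewrite /trace3 horner_sum; apply: eq_bigr => i _; rewrite hornerXn.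
Qed.

Lemma X3exp_dvd_genPoly M : (M %| N)%N ->
  ('X^(3 ^ M) - 'X : {poly L}) %| 'X^#|L| - 'X.
Proof. by rewrite cardL => /dvdnP[r ->]; rewrite mulnC; apply: dvdp_X3exp. Qed.

(** The polynomial [trace3 M X] divides its cube minus itself, that is
    [X^(3^M) - X], so all its roots are distinct and lie in L. *)
Lemma card_trace3_ker M : (0 < M)%N -> (M %| N)%N ->
  #|[set x : L | trace3 M x == 0]| = (3 ^ M.-1)%N.
Proof.
move=> M_gt0 M_N; pose p : {poly L} := trace3 M 'X.
transitivity #|[set x | root p x]|.
  by apply: eq_card => x; rewrite !inE rootE horner_trace3X.
rewrite card_roots_dvd ?size_trace3X //.
apply: dvdp_trans (X3exp_dvd_genPoly M_N).
by rewrite -trace3_AS ?pchar_poly // dvdp_sub // dvdp_exp.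
Qed.

(** On the subfield with 3 ^ M elements [trace3 N] is N / M times [trace3 M], so
    it has the same kernel or is zero, according to N / M modulo 3. *)
Lemma card_fix_trace3 M : (0 < M)%N -> (M %| N)%N ->
  #|[set x : L | (x ^+ (3 ^ M) == x) && (trace3 N x != 0)]| =
  if (3 %| N %/ M)%N then 0%N else (2 * 3 ^ M.-1)%N.
Proof.
move=> M_gt0 M_N.
have DN : N = (M * (N %/ M))%N by rewrite mulnC divnK.
case: ifP => [r3 | r3].
  apply: eq_card0 => x; rewrite !inE; apply/negP => /andP[/eqP xM /eqP[]].
  rewrite DN trace3_sub //; move: r3; rewrite (dvdn_pcharf charL) => /eqP->.
  by rewrite mul0r.
pose K := [set x : L | x ^+ (3 ^ M) == x].
pose T := [set x : L | trace3 M x == 0].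
have subTK : T \subset K.
  apply/subsetP => x; rewrite !inE => /eqP Tx.
  by rewrite -subr_eq0 -trace3_AS // Tx expr0n subrr.
have cardK : #|K| = (3 ^ M)%N.
  transitivity #|[set x : L | root ('X^(3 ^ M) - 'X) x]|.
    by apply: eq_card => x; rewrite !inE rootE !hornerE subr_eq0.
  rewrite card_roots_dvd ?X3exp_dvd_genPoly // size_polyDl size_polyXn //.
  by rewrite size_polyN size_polyX ltnS (@ltn_exp2l 3 0).
transitivity #|K :\: T|.
  apply: eq_card => x; rewrite !inE andbC; apply: andb_id2r => /eqP xM.
  by rewrite DN trace3_sub // mulf_eq0 -(dvdn_pcharf charL) r3.
rewrite cardsD (setIidPr subTK) cardK card_trace3_ker //.
by case: (M) M_gt0 => // k _; rewrite expnS /= mulSn addKn.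
Qed.

(** The trace kills every z^3 - z. Conversely z |-> z^3 - z is at most
    three-to-one, so its image has at least |L| / 3 elements, which is the size
    of the kernel of the trace. *)
Lemma artin_schreier3 (b : L) : (0 < N)%N ->
  reflect (exists z, z ^+ 3 - z = b) (trace3 N b == 0).
Proof.
move=> N_gt0; pose f (z : L) := z ^+ 3 - z.
have imT : f @: L \subset [set x : L | trace3 N x == 0].
  apply/subsetP => _ /imsetP[z _ ->]; rewrite inE /f trace3D trace3N.
  by rewrite -{1}[3%N]expn1 trace3_frob subrr.
have imE : f @: L = [set x : L | trace3 N x == 0].
  apply/eqP; rewrite eqEcard imT card_trace3_ker //=.
  rewrite -(leq_pmul2r (isT : 0 < 3)%N) -expnSr prednK // -cardL -sum1_card.
  rewrite (partition_big f (mem (f @: L))) /=; last first.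
    by move=> z _; apply: imset_f.
  rewrite -sum_nat_const; apply: leq_sum => y _; rewrite sum1_card.
  have szp : size ('X^3 - 'X - y%:P : {poly L}) = 4.
    rewrite -addrA size_polyDl size_polyXn // -opprD size_polyN.
    by rewrite size_polyDl size_polyX // ltnS (leq_trans (size_polyC_leq1 _)).
  have pn0 : 'X^3 - 'X - y%:P != 0 by rewrite -size_poly_eq0 szp.
  have := card_roots_le pn0; rewrite szp; apply: leq_trans.
  apply/subset_leq_card/subsetP => z; rewrite !inE rootE !hornerE /f => /eqP<-.
  by rewrite subrr.
apply: (iffP idP) => [Tb | [z <-]].
  have: b \in f @: L by rewrite imE inE.
  by case/imsetP => z _ ->; exists z.
by have:= subsetP imT (f z); rewrite inE; apply; apply: imset_f.
Qed.

End Trace3.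

(** * The values of x^3 + x^2 on a finite field of characteristic three *)

Definition cubic_value (R : finNzRingType) (a : R) :=
  [exists x : R, x ^+ 3 + x ^+ 2 == a].

Section Cubic.

Variables (L : finFieldType) (e n : nat).
Hypothesis charL : 3%N \in [pchar L].
Hypothesis cardL : #|L| = (3 ^ (e * n))%N.
Hypothesis e_gt0 : (0 < e)%N.
Hypothesis n_gt1 : (1 < n)%N.
Local Notation T := (@trace3 L (e * n)).
Local Notation frob := (fun x : L => x ^+ (3 ^ e)).

Let N_gt0 : (0 < e * n)%N.
Proof. by rewrite muln_gt0 e_gt0 ltnW. Qed.

(** The change of variable x = b / z exchanges the equations x^3 + x^2 = b^2 and
    z^3 - z = b. *)
Lemma cubic_value_sqr (b : L) : b != 0 -> cubic_value (b ^+ 2) = (T b == 0).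
Proof.
move=> b0.
apply/existsP/(artin_schreier3 charL cardL b N_gt0) => [[x /eqP Dx] | [z Dz]].
  have x0 : x != 0.
    apply: contra_neq b0 => x0; apply/eqP.
    by rewrite -sqrf_eq0 -Dx x0 !expr0n addr0.
  exists (b / x).
  have -> : (b / x) ^+ 3 - b / x = b * (b ^+ 2 - x ^+ 2) / x ^+ 3 by field.
  by rewrite -Dx addrK mulfK // expf_neq0.
have z0 : z != 0 by apply: contra_neq b0 => z0; rewrite -Dz z0 expr0n subrr.
exists (b / z); apply/eqP.
have -> : (b / z) ^+ 3 + (b / z) ^+ 2 = b ^+ 2 * (b + z) / z ^+ 3 by field.
by rewrite -{2}Dz subrK mulfK // expf_neq0.
Qed.

(** The kernel of the additive map y |-> y^3 - y / a is trivial when a is not a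
    square, so the map is onto; x = 1 / y solves x^3 + x^2 = a when y is sent to
    1 / a. *)
Lemma cubic_value_nonsquare (a : L) :
  a != 0 -> (forall b, b ^+ 2 != a) -> cubic_value a.
Proof.
move=> a0 nsq; pose f (y : L) := y ^+ 3 - y / a.
have f_inj : injective f.
  move=> x y /eqP; rewrite -subr_eq0.
  have -> : f x - f y = f (x - y).
    by rewrite /f (expB_pow3 charL 1) mulrBl; ring.
  move=> /eqP fxy; apply/eqP; rewrite -subr_eq0; apply/negPn/negP => d0.
  (* A non-zero d in the kernel satisfies d^2 = 1 / a. *)
  case/eqP: (nsq (x - y)^-1); apply: (mulIf d0); apply: (mulIf d0).
  apply: (mulfI (invr_neq0 a0)); apply: (mulIf d0).
  transitivity ((x - y) / a); first by field; rewrite a0 d0.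
  by move/eqP: fxy; rewrite /f subr_eq0 => /eqP<-; field.
have [g _ gK] := injF_bij f_inj; have := gK a^-1; set y := g _ => Dy.
have y3 : y ^+ 3 = (1 + y) / a by rewrite mulrDl mul1r -{1}Dy /f subrK.
have y0 : y != 0.
  apply/eqP => y0; move: (invr_neq0 a0).
  by rewrite -Dy /f y0 expr0n mul0r subrr eqxx.
have y10 : 1 + y != 0.
  apply: contraNneq y0 => y10; have: y ^+ 3 == 0 by rewrite y3 y10 mul0r.
  by rewrite expf_eq0.
apply/existsP; exists y^-1; apply/eqP.
have -> : y^-1 ^+ 3 + y^-1 ^+ 2 = (1 + y) / y ^+ 3 by field.
by rewrite y3; field; rewrite a0 y10.
Qed.

Lemma cubic_valuePn (a : L) : a != 0 ->
  reflect (exists2 b, a = b ^+ 2 & T b != 0) (~~ cubic_value a).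
Proof.
move=> a0; apply: (iffP idP) => [nv | [b Db Tb]].
  have [/existsP[b /eqP Db] | nsq] := boolP [exists b, b ^+ 2 == a].
    exists b => //; rewrite -cubic_value_sqr ?Db //.
    by apply: contra_neq a0 => b0; rewrite -Db b0 expr0n.
  case/negP: nv; apply: cubic_value_nonsquare => // b.
  by apply: contraNneq nsq => Db; apply/existsP; exists b; rewrite Db.
rewrite Db cubic_value_sqr //; apply: contra_neq a0 => b0.
by rewrite Db b0 expr0n.
Qed.

Lemma frob_inj : injective frob.
Proof.
move=> x y /eqP; rewrite -subr_eq0 -expB_pow3 // expf_eq0 subr_eq0.
by case/andP => _ /eqP.
Qed.

Lemma iter_frob k x : iter k frob x = x ^+ (3 ^ (e * k)).
Proof.
elim: k => [|k IH]; first by rewrite muln0.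
by rewrite iterS IH -exprM -expnD mulnS addnC.
Qed.

Lemma order_frob_dvd x k : (order frob x %| k)%N = (x ^+ (3 ^ (e * k)) == x).
Proof. by rewrite -iter_id_order ?iter_frob //; apply: frob_inj. Qed.

Lemma order_frob_neq0 x : order frob x = n -> x != 0.
Proof.
move=> ox; apply: contraTneq n_gt1 => x0.
have : (order frob x %| 1)%N by rewrite order_frob_dvd x0 expr0n expn_eq0.
by rewrite dvdn1 ox => /eqP->.
Qed.

Lemma neq_opp_char3 (x : L) : x != 0 -> x != - x.
Proof.
move=> x0; rewrite -addr_eq0 -mulr2n -mulr_natl mulf_eq0 negb_or x0 andbT.
by rewrite -(dvdn_pcharf charL).
Qed.

(** If d is the orbit length of b^2, the d-th iterate of Frobenius sends b to b
    or to -b; as it preserves the trace, the second case would give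
    T b = - T b. *)
Lemma order_frob_sqr (b : L) : T b != 0 -> order frob (b ^+ 2) = order frob b.
Proof.
move=> Tb; set d := order _ (b ^+ 2).
apply/eqP; rewrite eqn_dvd; apply/andP; split.
  by rewrite order_frob_dvd exprAC -iter_frob iter_order //; apply: frob_inj.
have : (b ^+ (3 ^ (e * d))) ^+ 2 == b ^+ 2 by rewrite exprAC -order_frob_dvd.
rewrite eqf_sqr order_frob_dvd => /orP[// | /eqP Db].
have: T b = - T b by rewrite -(trace3N charL) -Db (trace3_frob charL cardL).
by move/eqP; rewrite (negPf (neq_opp_char3 Tb)).
Qed.

(** Squaring is two-to-one between these sets: the fibre of b^2 is {b, -b}. *)
Lemma card_trace_noncubic :
  #|[set b : L | (order frob b == n) && (T b != 0)]| =
  (2 * #|[set a : L | (order frob a == n) && ~~ cubic_value a]|)%N.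
Proof.
set B := [set b : L | _]; set A := [set a | _].
rewrite -sum1_card (partition_big (fun b => b ^+ 2) (mem A)) /=; last first.
  move=> b; rewrite !inE => /andP[/eqP ob Tb].
  rewrite order_frob_sqr // ob eqxx.
  by rewrite cubic_value_sqr // order_frob_neq0.
rewrite mulnC -sum_nat_const; apply: eq_bigr => a.
rewrite inE => /andP[/eqP oa nv].
have a0 := order_frob_neq0 oa.
have [b Da Tb] := cubic_valuePn a0 nv.
have ob : order frob b = n by rewrite -order_frob_sqr // -Da.
transitivity #|[set b; - b]|; last first.
  by rewrite cards2 neq_opp_char3 // order_frob_neq0.
rewrite sum1_card; apply: eq_card => c.
rewrite !inE unfold_in /= !inE Da eqf_sqr.
rewrite andbC; case: (altP (c =P b)) => [->|_] /=; first by rewrite ob eqxx.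
case: (altP (c =P - b)) => [->|_] //=.
have TN : T (- b) != 0 by rewrite (trace3N charL) oppr_eq0.
by rewrite TN -(order_frob_sqr TN) sqrrN -Da oa eqxx.
Qed.

Lemma card_order_trace :
  3%:R * #|[set b : L | (order frob b == n) && (T b != 0)]|%:R =
  2%:R * \sum_(d <- divisors n | ~~ (3 %| d)%N)
           mobius d * (3 ^ (e * (n %/ d)))%N%:R.
Proof.
have n_gt0 := ltnW n_gt1.
rewrite mobius_order //; last exact: frob_inj.
rewrite [in RHS]big_mkcond !mulr_sumr; apply: eq_big_seq => d.
rewrite -dvdn_divisors // => d_n.
have d_gt0 := dvdn_gt0 n_gt0 d_n.
have nd_gt0 : (0 < n %/ d)%N by rewrite divn_gt0 // dvdn_leq.
under [X in #|pred_of_set X|]eq_finset do rewrite iter_frob.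
rewrite (card_fix_trace3 charL cardL) ?muln_gt0 ?e_gt0 //; last first.
  by rewrite dvdn_pmul2l //; apply/dvdnP; exists d; rewrite mulnC divnK.
rewrite divnMl // divnA // mulKn //.
case: ifP => _; rewrite ?mulr0 //=.
have -> : (3 ^ (e * (n %/ d)) = 3 * 3 ^ (e * (n %/ d)).-1)%N.
  by rewrite -expnS prednK // muln_gt0 e_gt0.
by rewrite !natrM; ring.
Qed.

End Cubic.

(** * Irreducible polynomials and their roots in extensions *)

Lemma reducible_factor (F : finFieldType) (p : {poly F}) :
  (1 < size p)%N -> ~ irreducible_poly p ->
  exists q, [/\ q %| p, (1 < size q)%N & (size q < size p)%N].
Proof.
move=> p_gt1 /irreducibleP; rewrite /irreducibleb p_gt1 /= => /forallPn[q].
rewrite negb_imply -Pdiv.Idomain.dvdpE -ltnNge => /andP[q_p q_gt1].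
exists q; split=> //; apply: leq_ltn_trans (size_npoly q) _.
by rewrite prednK // ltnW.
Qed.

Lemma irreducible_factor (F : finFieldType) (p : {poly F}) :
  (1 < size p)%N -> exists2 r, irreducible_poly r & r %| p.
Proof.
have [m] := ubnP (size p); elim: m p => // m IH p ltm p_gt1.
have [irr_p | /(reducible_factor p_gt1)[q [q_p q_gt1 ltqp]]] := irreducibleP p.
  by exists p.
have [r irr_r r_q] := IH q (leq_trans ltqp ltm) q_gt1.
by exists r; rewrite // (dvdp_trans r_q).
Qed.

Section MinPoly.

Variables (F : fieldType) (L : fieldExtType F).
Local Notation "p ^%:A" := (map_poly (in_alg L) p).

Lemma irreducible_minPoly (p : {poly F}) (x : L) :
  irreducible_poly p -> root p^%:A x -> p^%:A %= minPoly 1 x.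
Proof.
move=> [p_gt1 p_irr] px.
have /polyOver1P[m Dm] := minPolyOver 1 x.
have m_p : m %| p.
  by rewrite -(dvdp_map (in_alg L)) -Dm minPoly_dvdp ?alg_polyOver.
have szm : size m != 1%N.
  by rewrite -(size_map_poly (in_alg L)) -Dm size_minPoly.
by rewrite Dm eqp_map eqp_sym; apply: p_irr.
Qed.

Lemma irreducible_size (p : {poly F}) (x : L) :
  irreducible_poly p -> root p^%:A x -> size p = (adjoin_degree 1 x).+1.
Proof.
move=> irr_p px; rewrite -(size_map_poly (in_alg L)).
by rewrite (eqp_size (irreducible_minPoly irr_p px)) size_minPoly.
Qed.

Lemma irreducible_dvdp (p r : {poly F}) (x : L) :
  irreducible_poly p -> root p^%:A x -> root r^%:A x -> p %| r.
Proof.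
move=> irr_p px rx; rewrite -(dvdp_map (in_alg L)).
rewrite (eqp_dvdl _ (irreducible_minPoly irr_p px)).
by rewrite minPoly_dvdp ?alg_polyOver.
Qed.

Lemma adjoin_degree_dvdn (x : L) : (adjoin_degree 1 x %| \dim {:L})%N.
Proof.
by have := field_dimS (subvf <<1; x>>); rewrite dim_Fadjoin dimv1 muln1.
Qed.

Lemma irreducible_of_minPoly (p : {poly F}) (x : L) :
  p^%:A = minPoly 1 x -> irreducible_poly p.
Proof.
move=> Dp; split=> [|r szr r_p].
  by rewrite -(size_map_poly (in_alg L)) Dp size_minPoly.
have := minPoly_irr (alg_polyOver 1 r) (x := x); rewrite -Dp dvdp_map r_p.
case/(_ isT)/orP; first by rewrite eqp_map.
by rewrite -size_poly_eq1 size_map_poly (negPf szr).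
Qed.

End MinPoly.

(** * The Frobenius map of a finite extension of a finite field *)

Lemma frob_galois (F : finFieldType) (L : splittingFieldType F) :
  {a : gal_of {:L} | forall k x, (a ^+ k)%g x = x ^+ (#|F| ^ k)}.
Proof.
have [a _ Da] := finField_galois_generator (sub1v {:L}); exists a => k x.
elim: k => [|k IH]; first by rewrite gal_id expr1.
by rewrite expgSr galM ?memvf // IH Da ?memvf // dimv1 expn1 expnSr exprM.
Qed.

Section FiniteExtension.

Variables (F : finFieldType) (L0 : fieldExtType F).
Local Notation L := (finvect_type L0).
Local Notation n := (\dim {:L}).
Local Notation frob := (fun x : L => x ^+ #|F|).
Local Notation "p ^%:A" := (map_poly (in_alg L) p).

Lemma card_finvect : #|L| = (#|F| ^ n)%N.
Proof. by rewrite -card_vspace; apply: eq_card => x; rewrite memvf. Qed.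

Lemma iter_frobF k x : iter k frob x = x ^+ (#|F| ^ k).
Proof.
elim: k => [|k IH]; first by rewrite expr1.
by rewrite iterS IH -exprM -expnSr.
Qed.

Lemma frobF_inj : injective frob.
Proof.
have iter_n x : iter n frob x = x by rewrite iter_frobF -card_finvect expf_card.
have n_gt0 : (0 < n)%N by apply: adim_gt0.
by apply: (can_inj (g := iter n.-1 frob)) => x; rewrite -iterSr prednK.
Qed.

(** Fermat's little theorem in F(x) bounds the orbit length by the degree.
    Conversely the iterate of Frobenius that fixes x fixes the whole of F(x),
    which then has at most |F| ^ (orbit length) elements. *)
Lemma order_frobF x : order frob x = adjoin_degree 1 x.
Proof.
set o := order frob x; set m := adjoin_degree 1 x.
have dimK : \dim <<1; x>> = m by rewrite dim_Fadjoin dimv1 muln1.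
have o_m : (o %| m)%N.
  rewrite -iter_id_order ?iter_frobF; last exact: frobF_inj.
  by rewrite -dimK -Fermat's_little_theorem memv_adjoin.
apply/eqP; rewrite eqn_leq dvdn_leq //= -(leq_exp2l _ _ (finNzRing_gt1 F)).
rewrite -{1}dimK -card_vspace.
have [a aE] := frob_galois L.
have sub : (<<1; x>> <= fixedSpace (a ^+ o)%g)%VS.
  rewrite sub_adjoin1v; apply/fixedSpaceP.
  by rewrite aE -iter_frobF iter_order //; apply: frobF_inj.
pose p : {poly L} := 'X^(#|F| ^ o) - 'X.
have q_gt1 : (1 < #|F| ^ o)%N.
  by rewrite -(expn0 #|F|) ltn_exp2l ?order_gt0 ?finNzRing_gt1.
have szp : size p = (#|F| ^ o).+1.
  by rewrite size_polyDl size_polyXn // size_polyN size_polyX.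
have p0 : p != 0 by rewrite -size_poly_eq0 szp.
have := card_roots_le p0; rewrite szp; apply: leq_trans.
apply/subset_leq_card/subsetP => y /(subvP sub)/fixedSpaceP.
by rewrite aE inE rootE !hornerE => ->; rewrite subrr.
Qed.

Lemma horner_iter_frob (p : {poly F}) k (x : L) :
  p^%:A.[iter k frob x] = iter k frob p^%:A.[x].
Proof.
have [a aE] := frob_galois L; rewrite !iter_frobF -!aE -horner_map /=.
congr (_.[_]); rewrite -map_poly_comp; apply: eq_map_poly => y /=.
by rewrite linearZ rmorph1.
Qed.

(** The field F[X]/(p) also has |F| ^ n elements, so the class of X is a root of
    [X^(|F|^n) - X]; hence p divides that polynomial, which splits in L. *)
Lemma card_irreducible_roots (p : {poly F}) :
  irreducible_poly p -> size p = n.+1 -> #|[set x : L | root p^%:A x]| = n.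
Proof.
move=> irr_p szp; have [K dimK [z pz _]] := irredp_FAdjoin irr_p.
rewrite szp /= in dimK.
have p_dvd : p %| 'X^(#|F| ^ n) - 'X.
  apply: irreducible_dvdp irr_p pz _.
  rewrite rmorphB /= map_polyXn map_polyX rootE !hornerE subr_eq0 -dimK.
  by rewrite -(Fermat's_little_theorem {:K}%AS) memvf.
rewrite card_roots_dvd; first by rewrite size_map_poly szp.
rewrite card_finvect; move: p_dvd; rewrite -(dvdp_map (in_alg L)).
by rewrite rmorphB /= map_polyXn map_polyX.
Qed.

Lemma irreducible_roots_conj (p : {poly F}) (x y : L) :
  irreducible_poly p -> size p = n.+1 -> root p^%:A x -> root p^%:A y ->
  exists k, y = iter k frob x.
Proof.
move=> irr_p szp px py.
suff : fconnect frob x y by move/iter_findex<-; eexists.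
have sub : [set z | fconnect frob x z] \subset [set z : L | root p^%:A z].
  apply/subsetP => z; rewrite !inE => /iter_findex<-.
  rewrite rootE horner_iter_frob (rootP px) iter_frobF expr0n.
  by rewrite expn_eq0 (gtn_eqF (ltnW (finNzRing_gt1 F))).
(* The orbit of x has n elements, as many as p has roots. *)
have /eqP/setP/(_ y) :
    [set z | fconnect frob x z] == [set z : L | root p^%:A z].
  rewrite eqEcard sub card_irreducible_roots //.
  suff -> : #|[set z | fconnect frob x z]| = n by rewrite leqnn.
  rewrite cardsE -[RHS]/(n.+1.-1) -szp (irreducible_size irr_p px) /=.
  exact: order_frobF.
by rewrite !inE py.
Qed.

(** A root z of r generates a field of degree deg r over F, and that field
    contains F(g(z)), of degree deg f because g(z) is a root of f. *)
Lemma comp_factor_degree (f g r : {poly F}) :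
  irreducible_poly f -> irreducible_poly r -> r %| f \Po g ->
  ((size f).-1 %| (size r).-1)%N.
Proof.
move=> irr_f irr_r r_fg; have [K <- [z rz _]] := irredp_FAdjoin irr_r.
have fz : root (map_poly (in_alg K) f) (map_poly (in_alg K) g).[z].
  rewrite /root -horner_comp -map_comp_poly -rootE.
  by apply: root_dvdp rz; rewrite dvdp_map.
by rewrite (irreducible_size irr_f fz) adjoin_degree_dvdn.
Qed.

(** Capelli's lemma for a cubic g. A root of f(g) in L has degree at most n, so
    it excludes irreducibility. If g misses x, no irreducible factor of f(g) has
    degree n: it would have a root y in L, g(y) would be a conjugate of x, and
    g would take the value x at a conjugate of y. All irreducible factors then
    have degree at least 2n, so that two of them exceed the degree 3n of
    f(g). *)
Lemma irreducible_comp_cubic (f g : {poly F}) (x : L) :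
  irreducible_poly f -> size f = n.+1 -> size g = 4 -> root f^%:A x ->
  irreducible_poly (f \Po g) <-> forall y : L, g^%:A.[y] != x.
Proof.
move=> irr_f szf szg fx.
have n_gt0 : (0 < n)%N by apply: adim_gt0.
have szfg : size (f \Po g) = (n * 3).+1.
  have := size_comp_poly f g; rewrite szf szg /= => /(congr1 succn) <-.
  by rewrite prednK // size_poly_gt0 comp_poly_eq0 ?szg // -size_poly_eq0 szf.
have root_fg y : root (f \Po g)^%:A y = root f^%:A g^%:A.[y].
  by rewrite /root map_comp_poly horner_comp.
split=> [irr_fg y | no_y].
  apply/eqP => Dx; have fgy : root (f \Po g)^%:A y by rewrite root_fg Dx.
  have := dvdn_leq n_gt0 (adjoin_degree_dvdn y).
  have := irreducible_size irr_fg fgy; rewrite szfg => -[<-].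
  by rewrite leqNgt -{1}(muln1 n) ltn_pmul2l.
have no_r r : irreducible_poly r -> r %| f \Po g -> size r != n.+1.
  move=> irr_r r_fg; apply/eqP => szr.
  have /card_gt0P[y] : (0 < #|[set y : L | root r^%:A y]|)%N.
    by rewrite card_irreducible_roots.
  rewrite inE => ry.
  have fgy : root f^%:A g^%:A.[y].
    by rewrite -root_fg; apply: root_dvdp ry; rewrite dvdp_map.
  have [k Dx] := irreducible_roots_conj irr_f szf fgy fx.
  by case/eqP: (no_y (iter k frob y)); rewrite horner_iter_frob.
have fg_gt1 : (1 < size (f \Po g))%N by rewrite szfg ltnS muln_gt0 n_gt0.
have [// | /(reducible_factor fg_gt1)[q [q_fg q_gt1 ltq]]] :=
  irreducibleP (f \Po g).
have fg0 : f \Po g != 0 by rewrite -size_poly_gt0 ltnW.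
have Dfg := divpK q_fg; set s := _ %/ q in Dfg.
have q0 : q != 0 by rewrite -size_poly_gt0 ltnW.
have s0 : s != 0 by apply: contraNneq fg0 => s0; rewrite -Dfg s0 mul0r.
have szsq := size_mul s0 q0; rewrite Dfg szfg in szsq; rewrite szfg in ltq.
have Dsq : (size s + size q)%N = (n * 3).+2.
  by rewrite szsq prednK // addn_gt0 size_poly_gt0 s0.
have s_gt1 : (1 < size s)%N.
  by rewrite -(ltn_add2r (size q)) Dsq add1n ltnS.
have [r1 irr1 r1_s] := irreducible_factor s_gt1.
have [r2 irr2 r2_q] := irreducible_factor q_gt1.
have r1_fg : r1 %| f \Po g by rewrite -Dfg dvdp_mulr.
have r2_fg : r2 %| f \Po g by rewrite -Dfg dvdp_mull.
have large r : irreducible_poly r -> r %| f \Po g -> ((n * 2).+1 <= size r)%N.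
  move=> irr_r r_fg; have r_gt1 := irr_r.1.
  have r_gt0 : (0 < (size r).-1)%N by rewrite -ltnS prednK // ltnW.
  have := comp_factor_degree irr_f irr_r r_fg; rewrite szf => /dvdnP[k Dk].
  have := no_r r irr_r r_fg.
  rewrite -(prednK (ltnW r_gt1)) Dk eqSS ltnS /= mulnC.
  rewrite leq_pmul2l //; move: r_gt0; rewrite Dk.
  by case: k {Dk} => [|[|k]]; rewrite ?mul1n ?muln1 ?eqxx.
have := leq_add (leq_trans (large r1 irr1 r1_fg) (dvdp_leq s0 r1_s))
  (leq_trans (large r2 irr2 r2_fg) (dvdp_leq q0 r2_q)).
by rewrite Dsq addSn addnS !ltnS -mulnDr leq_pmul2l.
Qed.

End FiniteExtension.

(** In a splitting field of the separable polynomial [X^m - X], m = |F| ^ n, the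
    fixed field of the n-th power of Frobenius consists of the m roots, so it
    has dimension n over F. *)
Lemma finField_extension (F : finFieldType) (n : nat) : (0 < n)%N ->
  exists L : fieldExtType F, \dim {:L} = n.
Proof.
move=> n_gt0; pose m := (#|F| ^ n)%N.
have m_gt1 : (1 < m)%N by rewrite -(expn0 #|F|) ltn_exp2l ?finNzRing_gt1.
pose p (R : nzRingType) : {poly R} := 'X^m - 'X.
have szp (R : nzRingType) : size (p R) = m.+1.
  by rewrite size_polyDl size_polyXn // size_polyN size_polyX.
have /FinSplittingFieldFor[L [zs Dzs _]] : p F != 0.
  by rewrite -size_poly_eq0 szp.
rewrite rmorphB /= map_polyXn map_polyX -/(p L) in Dzs.
have m0 : m%:R = 0 :> L.
  have [r pr_r charF] := finPcharP F.
  have charL : r \in [pchar L] by rewrite pchar_lalg.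
  apply/eqP; rewrite -(dvdn_pcharf charL) /m Euclid_dvdX // n_gt0 andbT.
  have cardF : #|F| = (r ^ logn r #|F|)%N := card_pprimeChar charF.
  have := finNzRing_gt1 F; rewrite cardF; case: logn => // k _.
  by rewrite expnS dvdn_mulr.
have uzs : uniq zs.
  rewrite -separable_prod_XsubC -(eqp_separable Dzs) unlock.
  rewrite derivB derivXn derivX.
  rewrite -mulr_natl -polyC_natr m0 mul0r sub0r coprimep_sym -scaleN1r.
  by rewrite coprimepZl ?oppr_eq0 ?oner_eq0 ?coprime1p.
have [a aE] := frob_galois L.
pose E : {subfield L} := [aspace of fixedSpace (a ^+ n)%g].
exists (subvs_of E); rewrite dimvf /dim /=.
pose L' := finvect_type L.
have : #|(E : {vspace L'})| = m.
  transitivity #|[set z in (zs : seq L')]|.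
    apply: eq_card => z; rewrite inE -root_prod_XsubC -(eqp_root Dzs).
    by rewrite rootE !hornerE subr_eq0; apply/fixedSpaceP/eqP; rewrite aE.
  rewrite cardsE (card_uniqP _) //.
  by apply: succn_inj; rewrite -(size_prod_XsubC _ id) -(eqp_size Dzs) szp.
by rewrite card_vspace => /eqP; rewrite eqn_exp2l ?finNzRing_gt1 // => /eqP.
Qed.

(** * Counting the irreducible polynomials *)

Lemma rat_subst1 (F : fieldType) (n : nat) (g f : {poly F}) :
  size f = n.+1 -> rat_subst n g 1 f = f \Po g.
Proof.
move=> szf; rewrite comp_polyE szf /rat_subst.
by apply: eq_bigr => i _; rewrite expr1n mulr1.
Qed.

Section Count.

Variables (F : finFieldType) (L0 : fieldExtType F).
Local Notation L := (finvect_type L0).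
Local Notation n := (\dim {:L}).
Local Notation frob := (fun x : L => x ^+ #|F|).
Local Notation "p ^%:A" := (map_poly (in_alg L) p).

(** Both sides count the pairs (f, a) of an f in the set and a root a of f in L:
    each f has n roots, and the only irreducible monic polynomial with root a is
    the minimal polynomial of a. *)
Lemma card_irr_subst_set (g : {poly F}) : size g = 4 ->
  (n * #|irr_subst_set g 1 n|)%N =
  #|[set a : L | (order frob a == n) && [forall y : L, g^%:A.[y] != a]]|.
Proof.
move=> szg; set I := irr_subst_set _ _ _; set A := [set a | _].
have inI (f : {poly_(n.+1) F}) : f \in I ->
    [/\ size f = n.+1 :> nat, (f : {poly F}) \is monic, irreducible_poly f &
        irreducible_poly ((f : {poly F}) \Po g)].
  rewrite inE => /and4P[/eqP szf mon_f /irreducibleP irr_f /irreducibleP].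
  by rewrite rat_subst1.
rewrite mulnC -sum_nat_const.
rewrite (eq_bigr (fun f : {poly_(n.+1) F} =>
  \sum_(a : L) (root f^%:A a : nat))%N); last first.
  move=> f /inI[szf _ irr_f _].
  apply: etrans (esym (card_irreducible_roots irr_f szf)) _.
  rewrite -sum1_card big_mkcond; apply: eq_bigr => a _.
  by rewrite inE; case: (root _ _).
rewrite exchange_big /= -sum1_card [RHS]big_mkcond /=; apply: eq_bigr => a _.
have [ | aA] := boolP (a \in A); last first.
  apply: big1 => f fI; have [szf mon_f irr_f irr_fg] := inI f fI.
  apply/eqP; rewrite eqb0; apply: contra aA => fa; rewrite inE.
  apply/andP; split.
    by rewrite order_frobF -eqSS -(irreducible_size irr_f fa) szf.
  by apply/forallP; apply/(irreducible_comp_cubic irr_f szf szg fa).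
rewrite inE => /andP[/eqP oa /forallP noy].
rewrite order_frobF in oa.
have /polyOver1P[f0 Df0] := minPolyOver 1 a.
have szf0 : size f0 = n.+1.
  by rewrite -(size_map_poly (in_alg L)) -Df0 size_minPoly oa.
have irr_f0 : irreducible_poly f0 by apply: (irreducible_of_minPoly (x := a)).
have f0a : root f0^%:A a by rewrite -Df0 root_minPoly.
have mon_f0 : f0 \is monic.
  by rewrite -(map_monic (in_alg L)) -Df0 monic_minPoly.
have szf0' : (size f0 <= n.+1)%N by rewrite szf0.
pose f := NPoly szf0'.
have fI : f \in I.
  rewrite inE /= szf0 eqxx mon_f0 rat_subst1 //=.
  apply/andP; split; apply/irreducibleP => //.
  by apply/(irreducible_comp_cubic irr_f0 szf0 szg f0a).
rewrite (bigD1 f) //= f0a big1 // => h /andP[hI nhf].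
have [szh mon_h irr_h _] := inI h hI.
apply/eqP; rewrite eqb0; apply: contra nhf => ha; rewrite -val_eqE /=.
rewrite -eqp_monic // /eqp (irreducible_dvdp irr_h ha f0a).
exact: irreducible_dvdp irr_f0 f0a ha.
Qed.

End Count.

Lemma divisors_part3 n d : (0 < n)%N ->
  ((d %| n)%N && ~~ (3 %| d)%N) = (d %| n %/ n`_3)%N.
Proof.
move=> n_gt0; have Dm : (n %/ n`_3 = n`_3^')%N.
  by rewrite -{1}(partnC 3%N n_gt0) mulKn ?part_gt0.
rewrite Dm; apply/andP/idP => [[d_n n3d] | d_m].
  rewrite -(partnC 3%N n_gt0) Gauss_dvdr // in d_n.
  by rewrite p_part coprimeXr // coprime_sym prime_coprime.
split; first by apply: dvdn_trans d_m (dvdn_part _ _).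
have := part_pnat 3%N^' n; move/(pnat_dvd d_m).
by rewrite p'natE.
Qed.

Theorem theorem16 (F : finFieldType) (charF : 3%N \in [pchar F])
    (n : nat) (hn : (1 < n)%N) :
  #|irr_subst_set ('X^3 + 'X^2 : {poly F}) 1 n|%:R =
    (3 * n`_3)%N%:R^-1 * necklace (n %/ n`_3)%N ((#|F| ^ n`_3)%N%:Z) :> rat.
Proof.
have n_gt0 := ltnW hn.
have [L0 dimL0] := finField_extension F n_gt0; pose L := finvect_type L0.
have charL : 3%N \in [pchar L] by rewrite pchar_lalg.
pose e := logn 3 #|F|.
have cardF : #|F| = (3 ^ e)%N by exact: card_pprimeChar charF.
have e_gt0 : (0 < e)%N.
  by move: (finNzRing_gt1 F); rewrite cardF -{1}(expn0 3) ltn_exp2l.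
have cardL : #|L| = (3 ^ (e * n))%N by rewrite card_finvect dimL0 cardF expnM.
have szg : size ('X^3 + 'X^2 : {poly F}) = 4.
  by rewrite size_polyDl size_polyXn // size_polyXn.
set k := #|irr_subst_set _ _ _|; set c := (n`_3)%N; set m := (n %/ c)%N.
have Dn : n = (c * m)%N by rewrite mulnC divnK ?dvdn_part.
have m_gt0 : (0 < m)%N by rewrite divn_gt0 ?part_gt0 // dvdn_leq ?dvdn_part.
have count : (n * k)%N =
    #|[set a : L | (order (fun x : L => x ^+ (3 ^ e)) a == n) &&
                   ~~ cubic_value a]|.
  have := card_irr_subst_set L0 szg; rewrite dimL0 -/k => ->.
  apply: eq_card => a; rewrite !inE cardF; congr (_ && _).
  rewrite negb_exists; apply: eq_forallb => y.
  by rewrite rmorphD /= !map_polyXn !hornerE.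
have sum_k : (3 * n * k)%N%:R =
    \sum_(d <- divisors m) mobius d * ((#|F| ^ c)%N%:Z) ^+ (m %/ d) :> int.
  have := card_order_trace charL cardL e_gt0 hn.
  rewrite (card_trace_noncubic charL cardL e_gt0 hn) -count.
  rewrite natrM mulrCA => /(mulfI (_ : 2%:R != 0 :> int))-/(_ isT).
  rewrite -natrM mulnA => ->; rewrite -big_filter.
  rewrite (perm_big (divisors m)) /=; last first.
    apply: uniq_perm; rewrite ?filter_uniq ?divisors_uniq // => d.
    by rewrite mem_filter andbC -!dvdn_divisors // divisors_part3.
  apply: eq_big_seq => d; rewrite -dvdn_divisors // => d_m; congr (_ * _).
  rewrite {1}Dn -muln_divA // mulnA expnM expnM -cardF.
  by rewrite natrX natz.
rewrite /necklace -rmorph_sum -sum_k /= {1}Dn.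
have c0 : c%:R != 0 :> rat by rewrite pnatr_eq0 -lt0n part_gt0.
have m0 : m%:R != 0 :> rat by rewrite pnatr_eq0 -lt0n.
by rewrite !natrM; clearbody m; field; rewrite m0 c0.
Qed.
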